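(* Let $X$ be a normal space of covering dimension at most $2$. Let $n\geq1$ be an integer. Let $f:X\to M_n^{\mathrm{sa}}$ and $\epsilon:X\to\mathbb{R}_{>0}$ be continuous. Then there exists a continuous map $g:X\to M_n^{\mathrm{sa}}$ such that for all $x\in X$, $\|f(x)-g(x)\|<\epsilon(x)$ and $g(x)$ has $n$ distinct eigenvalues.
   Context: $M_n^{\mathrm{sa}}$ is the set of self-adjoint complex $n\times n$ matrices (with the operator norm). A topological space is normal if any two disjoint closed subsets have disjoint neighborhoods (no Hausdorff assumption). Covering dimension: a space $X$ has dimension at most $d$ if every open covering of $X$ has an open refinement $(V_j)_{j\in J}$ such that each $x\in X$ lies in $V_j$ for at most $d+1$ indices $j$. *)

(* Defs.v *)
From HB Require Import structures.
From mathcomp Require Import all_boot all_order all_algebra complex.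
From mathcomp Require Import all_classical all_reals all_analysis.

Set Implicit Arguments.
Unset Strict Implicit.
Unset Printing Implicit Defensive.

Import Order.TTheory GRing.Theory Num.Theory.
Import numFieldNormedType.Exports.

Local Open Scope classical_set_scope.
Local Open Scope card_scope.
Local Open Scope ring_scope.

(* R[i] carries no topology in the libraries; we give it the one that
   MathComp-Analysis puts on every numFieldType, i.e. that of the modulus.
   Matrices over R[i] then inherit the product topology, which is the topology
   of the operator norm since all norms on 'M[R[i]]_n are equivalent. *)
HB.instance Definition _ (R : rcfType) := NormedModule.copy R[i] R[i]^o.

Definition covering_dim_le (X : topologicalType) (d : nat) : Prop :=
  forall (I : Type) (U : I -> set X),
    (forall i, open (U i)) -> \bigcup_i U i = setT ->
    exists (J : Type) (V : J -> set X),
      [/\ forall j, open (V j),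
          \bigcup_j V j = setT,
          forall j, exists i, V j `<=` U i
        & forall x, [set j | V j x] #<= `I_d.+1].

Definition l2norm (R : realType) (n : nat) (v : 'cV[R[i]]_n) : R :=
  Num.sqrt (\sum_(k < n) Normc.normc (v k 0) ^+ 2).

Definition opnorm (R : realType) (n : nat) (A : 'M[R[i]]_n) : R :=
  sup [set l2norm (A *m v) | v in [set v : 'cV[R[i]]_n | l2norm v <= 1]].

(* Main.v *)
Require Import Defs.
From mathcomp Require Import all_boot all_order all_algebra complex.
From mathcomp Require Import ring lra zify.
From mathcomp Require Import all_classical all_reals all_analysis.

(* The hermitian matrices with a repeated eigenvalue have codimension 3, so
   that a generic triangle avoids them. Quantitatively, H = L P L^* + l with P
   hermitian of size r <= n - 2 and r rows of L equal to the identity depends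
   polynomially on r^2 + 2 r (n - r) + 1 = n^2 - (n - r)^2 + 1 real parameters,
   hence for given A and B the matrices C such that C + s A + t B has a repeated
   eigenvalue for some s and t lie in finitely many polynomial images of
   dimension at most n^2 - 1. Such images miss points of every ball, since n^2
   polynomials in fewer variables are algebraically dependent.
   Pull back to X a countable cover of the space of pairs (matrix, epsilon) by
   small sets, refine it to a cover of order at most 3, shrink it to cozero sets
   {u_m > 0} (X being normal), and attach to each m a matrix A_m near the values
   of f there, chosen generically with respect to the previous ones. With
   weights w_m proportional to u_m, g = (sum w_m A_m) / (sum w_m) is at each
   point a positive multiple of A_m + s A_j + t A_k for some j, k < m. *)

Set Implicit Arguments.
Unset Strict Implicit.
Unset Printing Implicit Defensive.

Import Order.TTheory GRing.Theory Num.Theory.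
Import numFieldNormedType.Exports.

Local Open Scope classical_set_scope.
Local Open Scope card_scope.
Local Open Scope ring_scope.

(** * Images of polynomial maps from lower dimension *)

(** The degree is bounded in each variable separately, so that the monomials form the finite type of
    functions from [T] to ['I_k.+1] and can be counted. *)
Definition poly_le (R : fieldType) (T : finType) (k : nat)
    (phi : (T -> R) -> R) : Prop :=
  exists c : {ffun T -> 'I_k.+1} -> R,
    forall v, phi v = \sum_e c e * \prod_t v t ^+ e t.

Section PolyLe.
Context {R : fieldType} {T : finType}.
Implicit Types phi psi : (T -> R) -> R.

(** Gathers like monomials, so that the closure properties may exhibit any finite family of
    monomials, repetitions included. *)
Lemma poly_le_sum_monom (J : finType) (a : J -> R) (w : J -> T -> nat) k phi :
    (forall j t, (w j t <= k)%N) ->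
    (forall v, phi v = \sum_j a j * \prod_t v t ^+ w j t) ->
  poly_le k phi.
Proof.
move=> wk phiE; pose h j : {ffun T -> 'I_k.+1} := [ffun t => inord (w j t)].
exists (fun e => \sum_(j | h j == e) a j) => v.
rewrite phiE (partition_big h xpredT) //=; apply: eq_bigr => e _.
rewrite mulr_suml; apply: eq_bigr => j /eqP <-.
by congr (_ * _); apply: eq_bigr => t _; rewrite ffunE inordK ?ltnS.
Qed.

Lemma poly_le_cst k (a : R) : @poly_le R T k (fun=> a).
Proof.
apply: (@poly_le_sum_monom unit (fun=> a) (fun _ _ => 0%N)) => // v.
by rewrite big_const card_unit /= addr0 big1 ?mulr1.
Qed.

Lemma poly_le_var k (t : T) : (0 < k)%N -> @poly_le R T k (fun v => v t).
Proof.
move=> k0; apply: (@poly_le_sum_monom unit (fun=> 1) (fun _ s => (s == t) : nat)).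
  by move=> _ s; case: eqP.
move=> v; rewrite big_const card_unit /= addr0 mul1r (bigD1 t) //= eqxx expr1.
by rewrite big1 ?mulr1// => s /negPf ->.
Qed.

Lemma poly_leW k l phi : (k <= l)%N -> poly_le k phi -> poly_le l phi.
Proof.
move=> kl [c phiE].
apply: (@poly_le_sum_monom _ c (fun e t => e t)) phiE => e t.
by rewrite (leq_trans _ kl)// -ltnS.
Qed.

Lemma poly_leD k phi psi :
  poly_le k phi -> poly_le k psi -> poly_le k (fun v => phi v + psi v).
Proof.
move=> [c phiE] [c' psiE]; exists (fun e => c e + c' e) => v.
by rewrite phiE psiE -big_split; apply: eq_bigr => e _; rewrite mulrDl.
Qed.

Lemma poly_leM k l phi psi :
  poly_le k phi -> poly_le l psi -> poly_le (k + l) (fun v => phi v * psi v).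
Proof.
move=> [c phiE] [c' psiE].
apply: (@poly_le_sum_monom _ (fun p => c p.1 * c' p.2)
  (fun p t => (p.1 t + p.2 t)%N)) => [p t|v].
  by rewrite leq_add// -ltnS.
rewrite phiE psiE mulr_suml -(pair_bigA _ (fun e e' => c e * c' e' *
  \prod_t v t ^+ (e t + e' t))) /=.
apply: eq_bigr => e _; rewrite mulr_sumr; apply: eq_bigr => e' _.
by rewrite mulrACA -big_split; congr (_ * _); apply: eq_bigr => t _; rewrite exprD.
Qed.

Lemma poly_le_sum (J : Type) (r : seq J) k (F : J -> (T -> R) -> R) :
  (forall j, poly_le k (F j)) -> poly_le k (fun v => \sum_(j <- r) F j v).
Proof.
move=> Fk; elim: r => [|j r IH].
  have [c cE] := poly_le_cst k 0; exists c => v.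
  by rewrite big_nil; exact: cE.
have [c cE] := poly_leD (Fk j) IH; exists c => v.
by rewrite big_cons; exact: cE.
Qed.

Lemma poly_le_prod (J : Type) (r : seq J) k (F : J -> (T -> R) -> R) :
  (forall j, poly_le k (F j)) ->
  poly_le (size r * k) (fun v => \prod_(j <- r) F j v).
Proof.
move=> Fk; elim: r => [|j r IH].
  have [c cE] := poly_le_cst 0 1; exists c => v.
  by rewrite big_nil; exact: cE.
have [c cE] := poly_leM (Fk j) IH; exists c => v.
by rewrite big_cons; exact: cE.
Qed.

Lemma poly_leX k n phi : poly_le k phi -> poly_le (n * k) (fun v => phi v ^+ n).
Proof.
move=> phik; have [c cE] := poly_le_prod (nseq n tt) (fun=> phik).
move: c cE; rewrite size_nseq => c cE; exists c => v.
by rewrite -cE big_nseq iter_mulr mulr1.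
Qed.

End PolyLe.

Lemma wide_kernel (R : fieldType) (I J : finType) (M : I -> J -> R) :
    (#|J| < #|I|)%N ->
  exists2 c : I -> R, (exists i, c i != 0) & forall j, \sum_i c i * M i j = 0.
Proof.
move=> JI; pose A : 'M[R]_(#|I|, #|J|) := \matrix_(i, j) M (enum_val i) (enum_val j).
have : kermx A != 0.
  rewrite -mxrank_eq0 mxrank_ker -lt0n subn_gt0.
  exact: leq_ltn_trans (rank_leq_col _) JI.
case/rowV0Pn => u /sub_kermxP uA u0.
exists (fun i => u 0 (enum_rank i)).
  have /rV0Pn [k uk] := u0; exists (enum_val k).
  by rewrite enum_valK.
move=> j; have /matrixP/(_ 0 (enum_rank j)) := uA; rewrite !mxE => uAj.
rewrite -[RHS]uAj (reindex enum_rank) /=; last exact: (onW_bij _ (@enum_rank_bij I)).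
by apply: eq_bigr => i _; rewrite mxE !enum_rankK.
Qed.

(** The least d above (N K + 1)^(N - 1), which gives ((N K + 1) d)^(N - 1) < d^N: more monomials in
    the N polynomials than dimensions to hold them. *)
Definition dep_deg (N K : nat) : nat := ((N * K).+1 ^ N.-1).+1.

(* Counting: the d^N monomials of degree < d in the q_i live in a space of
   dimension at most (N K d)^(N - 1). *)
Lemma poly_le_dependent (R : fieldType) (T : finType) (N K : nat)
    (q : 'I_N -> (T -> R) -> R) :
    (#|T| < N)%N -> (forall i, poly_le K (q i)) ->
  exists2 c : {ffun 'I_N -> 'I_(dep_deg N K)} -> R, (exists e, c e != 0) &
    forall v, \sum_e c e * \prod_i q i v ^+ e i = 0.
Proof.
set d := dep_deg N K => TN qK; pose D := (N * (d.-1 * K))%N.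
have mon e : poly_le D (fun v => \prod_i q i v ^+ (e : {ffun 'I_N -> 'I_d}) i).
  have := @poly_le_prod R T 'I_N (index_enum 'I_N) (d.-1 * K)
    (fun i v => q i v ^+ e i).
  have -> : size (index_enum 'I_N) = N 
    by rewrite [index_enum _]unlock -enumT size_enum_ord.
  apply => i; apply: poly_leW (poly_leX (e i) (qK i)).
  by rewrite leq_mul2r -ltnS ltn_ord orbT.
have [b bE] := fin_all_exists mon.
have [|c c0 cb] := wide_kernel b.
  rewrite !card_ffun !card_ord.
  case: N TN @d @D q qK mon b bE => // N TN d D _ _ _ _ _.
  have D1 : (D.+1 <= (N.+1 * K).+1 * d)%N.
    rewrite /D /d /dep_deg /=; move: (_ ^ N)%N => m; nia.
  have leq_expr a b k : (a <= b -> a ^ k <= b ^ k)%N.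
    by case: k => // k ab; rewrite leq_exp2r.
  rewrite expnS; apply: (@leq_ltn_trans ((D.+1) ^ N)).
    by rewrite leq_pexp2l.
  apply: (@leq_ltn_trans (((N.+1 * K).+1 * d) ^ N)); first exact: leq_expr.
  by rewrite expnMn ltn_mul2r expn_gt0 /= /d /dep_deg.
exists c => // v; under eq_bigr do rewrite bE mulr_sumr.
rewrite exchange_big big1 //= => f _; under eq_bigr do rewrite mulrA.
by rewrite -mulr_suml cb mul0r.
Qed.

Lemma digits_inj (d N : nat) (e e' : 'I_N -> nat) :
    (forall i, e i < d)%N -> (forall i, e' i < d)%N ->
    (\sum_i e i * d ^ i = \sum_i e' i * d ^ i)%N ->
  e =1 e'.
Proof.
elim: N e e' => [|N IH] e e' ed e'd; first by move=> _ [].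
have d0 : (0 < d)%N by exact: leq_trans (ed ord0).
have shift (g : 'I_N.+1 -> nat) : (\sum_i g i * d ^ i =
    g ord0 + d * \sum_(i < N) g (lift ord0 i) * d ^ i)%N.
  rewrite big_ord_recl /= expn0 muln1 big_distrr /=; congr (_ + _)%N.
  by apply: eq_bigr => i _; rewrite expnS mulnCA.
rewrite !shift => E.
have e0 : e ord0 = e' ord0.
  have := congr1 (modn^~ d) E.
  by rewrite ![(_ + d * _)%N]addnC ![(d * _)%N]mulnC !modnMDl !modn_small.
move: E; rewrite e0 => /addnI/eqP; rewrite eqn_pmul2l // => /eqP /IH H i.
by case: (unliftP ord0 i) => [j|] -> //; apply: H.
Qed.

(* A generic point of the Kronecker curve s |-> y0 + (s, s^d, s^(d^2), ...)
   avoids any finite number of polynomial images of lower dimension: distinct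
   monomials in the coordinates restrict to distinct powers of s. *)
Lemma poly_image_avoid (R : realFieldType) (A : finType) (T : A -> finType)
    (N K : nat) (q : forall a, 'I_N -> (T a -> R) -> R) (y0 : 'I_N -> R) (del : R) :
    (forall a, #|T a| < N)%N -> (forall a i, poly_le K (q a i)) -> 0 < del ->
  exists2 y, (forall i, `|y i - y0 i| < del) &
    forall a v, exists i, q a i v != y i.
Proof.
move=> TN qK del0; set d := dep_deg N K.
have dep a : exists p : {poly R}, p != 0 /\ forall s v,
    (forall i, q a i v = y0 i + s ^+ (d ^ i)) -> p.[s] = 0.
  (* Recentred at [y0]: at a point of the curve the shifted coordinates are exactly the powers
     s^(d^i), and the relation becomes a polynomial in s. *)
  have [|i|c [e0 ce0] cE] := @poly_le_dependent R (T a) N K (fun i v => q a i v + - y0 i).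
  - exact: TN.
  - exact: poly_leD (poly_le_cst _ _).
  pose w (e : {ffun 'I_N -> 'I_d}) := (\sum_i e i * d ^ i)%N.
  exists (\sum_e c e *: 'X^(w e)); split.
    apply/eqP => /polyP/(_ (w e0)); rewrite coef0 coef_sum (bigD1 e0) //=.
    rewrite coefZ coefXn eqxx mulr1 big1 ?addr0; first exact/eqP.
    move=> e ee0; rewrite coefZ coefXn; case: eqP; rewrite ?mulr0 // => wE.
    case/eqP: ee0; apply/ffunP => i; apply/val_inj => /=; symmetry.
    exact: (digits_inj _ _ wE).
  move=> s v qE; rewrite -[RHS](cE v) horner_sum; apply: eq_bigr => e _.
  rewrite hornerZ hornerXn /w; congr (_ * _).
  rewrite -[RHS](_ : \prod_i s ^+ (e i * d ^ i) = _); last first.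
    by apply: eq_bigr => i _; rewrite qE [y0 i + _]addrC addrK mulnC exprM.
  elim/big_rec2: _ => [|i x y _ IH]; first by rewrite expr0.
  by rewrite exprD IH.
have [p pE] := fin_all_exists dep.
have P0 : \prod_a p a != 0 by apply/prodf_neq0 => a _; case: (pE a).
(* The numbers m / (k + 2) are distinct and lie strictly between 0 and m. As many are listed as the
   size of the product polynomial, more than its degree, so one is not a root. Being below 1 keeps
   every s^(d^i) at most s, hence below [del]. *)
pose m := Num.min del 1; have m0 : 0 < m by rewrite lt_min del0 ltr01.
pose rs := [seq m / k.+2%:R | k <- iota 0 (size (\prod_a p a))].
have [s sr sP] : exists2 s, s \in rs & ~~ root (\prod_a p a) s.
  apply/(@hasP _ (predC (root (\prod_a p a)))); rewrite has_predC.
  apply/negP => /roots_geq_poly_eq0 rs0.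
  move/eqP: P0; apply; apply: rs0; last by rewrite size_map size_iota.
  rewrite map_inj_uniq ?iota_uniq // => k l /(mulfI (lt0r_neq0 m0)) /invr_inj /eqP.
  by rewrite eqr_nat => /eqP [].
have /andP[s0 sm] : 0 < s < m.
  case/mapP: sr => k _ ->; rewrite divr_gt0 ?ltr0n //= ltr_pdivrMr ?ltr0n //.
  by rewrite ltr_pMr // ltr1n.
have [sd s1] : s < del /\ s < 1 by move: sm; rewrite lt_min => /andP.
exists (fun i => y0 i + s ^+ (d ^ i)) => [i|a v].
  rewrite addrAC subrr add0r ger0_norm ?exprn_ge0 ?ltW //.
  by apply: le_lt_trans sd; rewrite ler_iXnr ?ltW // expn_gt0.
apply/existsP; rewrite -negb_forall; apply: contra sP => /forallP qE.
rewrite /root horner_prod; apply/prodf_eq0; exists a => //; apply/eqP.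
by case: (pE a) => _; apply => i; apply/eqP.
Qed.

(** * Hermitian matrices with a repeated eigenvalue *)

Section HermitianCoordinates.
Context {R : rcfType} {n : nat}.
Local Notation C := R[i].

(* Re + Im: its values at the n^2 entries are real coordinates on the hermitian
   matrices, whose inverse is herm_of. *)
Definition rcoord (z : C) : R := complex.Re z + complex.Im z.

Definition herm_of (a : 'M[R]_n) : 'M[C]_n :=
  \matrix_(i, j) Complex ((a i j + a j i) / 2) ((a i j - a j i) / 2).

Definition herm_coord (H : 'M[C]_n) : 'M[R]_n := \matrix_(i, j) rcoord (H i j).

Lemma hermsymP (H : 'M[C]_n) :
  reflect (forall i j, H i j = (H j i)^*) (H \is hermsymmx).
Proof.
apply: (iffP (is_hermitianmxP _ _ _)); rewrite expr0 scale1r => E.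
  by move=> i j; rewrite {1}E !mxE.
by apply/matrixP => i j; rewrite !mxE.
Qed.

Lemma conj_Complex (x y : R) : (Complex x y)^* = Complex x (- y).
Proof. by []. Qed.

Lemma herm_of_herm a : herm_of a \is hermsymmx.
Proof.
apply/hermsymP => i j; rewrite !mxE conj_Complex; congr Complex; last by field.
by rewrite addrC.
Qed.

Lemma herm_coordK (H : 'M[C]_n) : H \is hermsymmx -> herm_of (herm_coord H) = H.
Proof.
move=> /hermsymP HH; apply/matrixP => i j; rewrite !mxE (HH j i).
by case: (H i j) => x y; rewrite conj_Complex /rcoord /=; congr Complex; field.
Qed.

Lemma herm_ofK a : herm_coord (herm_of a) = a.
Proof. by apply/matrixP => i j; rewrite !mxE /rcoord /=; field. Qed.

Lemma rcoord_herm_of a i j : rcoord (herm_of a i j) = a i j.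
Proof. by have /matrixP/(_ i j) := herm_ofK a; rewrite mxE. Qed.

Lemma herm_ofD a b : herm_of (a + b) = herm_of a + herm_of b.
Proof.
apply/matrixP => i j; rewrite !mxE -[RHS]/(Complex _ _).
by congr Complex; field.
Qed.

Lemma herm_ofZ (c : R) a : herm_of (c *: a) = (c%:C)%C *: herm_of a.
Proof.
apply/matrixP => i j; rewrite !mxE -[RHS]/(Complex _ _).
by congr Complex; field.
Qed.

Lemma rcoordD (y z : C) : rcoord (y + z) = rcoord y + rcoord z.
Proof. by case: y z => [y1 y2] [z1 z2]; rewrite /rcoord /= addrACA. Qed.

Lemma rcoordN (z : C) : rcoord (- z) = - rcoord z.
Proof. by case: z => [z1 z2]; rewrite /rcoord /= opprD. Qed.

(** For a hermitian matrix this says that l is an eigenvalue of multiplicity at least 2. Adding 2 to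
    the rank avoids truncated subtraction when n < 2. *)
Definition degenerate (a : 'M[R]_n) : Prop :=
  exists l : R, (\rank (herm_of a - ((l%:C)%C)%:M)%R + 2 <= n)%N.

Lemma degenerateZ (c : R) a : c != 0 -> degenerate (c *: a) -> degenerate a.
Proof.
move=> c0 [l lE]; exists (c^-1 * l).
have cC0 : (c%:C)%C != 0 :> C by rewrite eq_complex /= eqxx andbT.
rewrite -(eqmx_scale _ cC0) scalerBr -herm_ofZ scale_scalar_mx.
by rewrite -rmorphM mulrA mulfV // mul1r.
Qed.

(* Let f index a basis of the row space of H among its rows, so that H = L H_f;
   then H_f = (L P)^* = P L^* by symmetry, P being the submatrix of H on f. *)
Lemma hermitian_rank_decomp (H : 'M[C]_n) : H \is hermsymmx ->
  exists (f : {ffun 'I_(\rank H) -> 'I_n}) (L : 'M[C]_(n, \rank H))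
      (P : 'M[C]_(\rank H)),
    [/\ injective f, P \is hermsymmx, rowsub f L = 1%:M
      & H = L *m P *m map_mx Num.conj L^T].
Proof.
move=> /hermsymP HH.
pose f := maxrankfun H; have /submxP[L LE] : (H <= rowsub f H)%MS.
  by rewrite eq_maxrowsub.
(* The rows of H chosen by [f] are independent, so H_f cancels from L_f H_f = H_f. *)
have fL : rowsub f L = 1%:M.
  apply: (row_free_inj (maxrowsub_free H)); rewrite mul1mx mul_rowsub_mx.
  by rewrite -/f -LE.
have PH : mxsub f f H = map_mx Num.conj (mxsub f f H)^T.
  by apply/matrixP => i j; rewrite !mxE -HH.
exists f, L, (mxsub f f H); split => //; first exact: maxrankfun_inj.
  by apply/is_hermitianmxP; rewrite expr0 scale1r.
have cE : colsub f H = L *m mxsub f f H.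
  apply/matrixP => i j; have /matrixP/(_ i (f j)) := LE; rewrite !mxE => ->.
  by apply: eq_bigr => k _; rewrite !mxE.
have rE : rowsub f H = map_mx Num.conj (colsub f H)^T.
  by apply/matrixP => i j; rewrite !mxE -HH.
by apply: (etrans LE); rewrite rE cE trmx_mul map_mxM -PH mulmxA.
Qed.
End HermitianCoordinates.

(** Diagonalise H by a unitary P. If d_i = d_j with i and j distinct, rows i and j of P are
    independent and killed by H - d_i, whose rank is then at most n - 2; d_i is real since H is
    hermitian. *)
Lemma nondegenerate_spectrum (R : rcfType) n (a : 'M[R]_n) : ~ degenerate a ->
  exists2 d : 'I_n -> R[i], injective d &
    forall z, eigenvalue (herm_of a) z <-> exists i, z = d i.
Proof.
move=> nondeg; set H := herm_of a; have HH : H \is hermsymmx := herm_of_herm a.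
set P := spectralmx H; set d := spectral_diag H.
have HE : H = invmx P *m diag_mx d *m P by exact/orthomx_spectralP/hermitian_normalmx.
have Pu : P \in unitmx by exact: spectral_unit.
have row_eig i : row i P *m H = d 0 i *: row i P.
  rewrite HE rowE !mulmxA mulmxK // -rowE row_diag_mx -scalemxAl.
  by rewrite -rowE.
exists (fun i => d 0 i).
  move=> i j dij; apply/eqP/negP => /negP ij; apply: nondeg.
  have [l lE] : exists l : R, d 0 i = (l%:C)%C.
    have /mxOverP/(_ 0 i) := hermitian_spectral_diag_real HH.
    rewrite -/d; case: (d 0 i) => x y; rewrite complex_real => /eqP /= ->.
    by exists x.
  exists l; pose f (k : 'I_2) := if k == 0 then i else j.
  have f_inj : injective f.
    case=> [[|[|]]] // k [[|[|]]] // k'; rewrite /f /= => E;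
      by [apply/val_inj|move: ij; rewrite E eqxx].
  have Kfree : row_free (rowsub f P).
    rewrite -(mul1mx P) -mul_rowsub_mx /row_free mxrankMfree ?row_free_unit //.
    apply/row_freeP; exists (rowsub f 1%:M)^T; apply/matrixP => k k'.
    rewrite !mxE (bigD1 (f k)) //= !mxE eqxx mul1r big1 ?addr0.
      by rewrite (inj_eq f_inj) eq_sym.
    by move=> m /negPf mk; rewrite !mxE [f k == m]eq_sym mk mul0r.
  have : rowsub f P *m (H - ((l%:C)%C)%:M) = 0.
    apply/row_matrixP => k; rewrite row_mul row_rowsub row0 mulmxBr row_eig.
    rewrite mul_mx_scalar -lE /f; case: ifP => _; first by rewrite subrr.
    by rewrite dij subrr.
  move/mulmx0_rank_max; rewrite (eqP Kfree) => Hr.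
  by rewrite addnC.
move=> z; split=> [/eigenvalueP[v vH v0]|[i ->]]; last first.
  apply/eigenvalueP; exists (row i P); first exact: row_eig.
  apply/eqP => Pi0; have := mulmxK Pu (delta_mx 0 i : 'rV_n).
  rewrite -rowE Pi0 mul0mx => /matrixP/(_ 0 i); rewrite !mxE !eqxx => /eqP.
  by rewrite eq_sym oner_eq0.
(* The coordinates w of a left eigenvector in the basis of rows of P satisfy w_i d_i = z w_i, so a
   non-zero w_i gives z = d_i. *)
have wd : (v *m invmx P) *m diag_mx d = z *: (v *m invmx P).
  by rewrite scalemxAl -vH HE !mulmxA mulmxK.
have : v *m invmx P != 0.
  by apply: contra v0 => /eqP w0; rewrite -(mulmxKV Pu v) w0 mul0mx.
move: (v *m invmx P) wd => w wd /rV0Pn[i wi]; exists i; move/matrixP/(_ 0 i): wd.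
rewrite mul_mx_diag !mxE [RHS]mulrC => E.
by apply: (mulfI wi); rewrite -E.
Qed.

(** * Polynomial charts for the matrices that become degenerate after two shifts *)

Section Charts.
Context {R : rcfType} {n : nat}.
Local Notation C := R[i].

Definition cpoly_le (T : finType) k (phi : (T -> R) -> C) : Prop :=
  poly_le k (fun v => complex.Re (phi v)) /\ poly_le k (fun v => complex.Im (phi v)).

Lemma eq_poly_le (T : finType) k (phi psi : (T -> R) -> R) :
  phi =1 psi -> poly_le k phi -> poly_le k psi.
Proof. by move=> E [c cE]; exists c => v; rewrite -E. Qed.

Lemma poly_leMl (T : finType) k (c : R) (phi : (T -> R) -> R) :
  poly_le k phi -> poly_le k (fun v => c * phi v).
Proof. by move=> phik; apply: (@poly_leM _ _ 0) => //; exact: poly_le_cst. Qed.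

Lemma cpoly_leM (T : finType) k l (phi psi : (T -> R) -> C) :
  cpoly_le k phi -> cpoly_le l psi -> cpoly_le (k + l) (fun v => phi v * psi v).
Proof.
move=> [rphi iphi] [rpsi ipsi]; split.
  apply: (@eq_poly_le _ _ (fun v => complex.Re (phi v) * complex.Re (psi v) +
      (-1) * (complex.Im (phi v) * complex.Im (psi v)))).
    by move=> v; case: (phi v) (psi v) => [? ?] [? ?]; rewrite mulN1r.
  by apply: poly_leD; [exact: poly_leM|apply/poly_leMl/poly_leM].
apply: (@eq_poly_le _ _ (fun v => complex.Re (phi v) * complex.Im (psi v) +
    complex.Im (phi v) * complex.Re (psi v))).
  by move=> v; case: (phi v) (psi v) => [? ?] [? ?].
by apply: poly_leD; exact: poly_leM.
Qed.

Lemma cpoly_le_conj (T : finType) k (phi : (T -> R) -> C) :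
  cpoly_le k phi -> cpoly_le k (fun v => (phi v)^*).
Proof.
move=> [rphi iphi]; split.
  by apply: eq_poly_le rphi => v; case: (phi v).
apply: (@eq_poly_le _ _ (fun v => (-1) * complex.Im (phi v))).
  by move=> v; case: (phi v) => ? ?; rewrite mulN1r.
exact: poly_leMl.
Qed.

Lemma cpoly_le_sum (T : finType) (J : Type) (r : seq J) k (F : J -> (T -> R) -> C) :
  (forall j, cpoly_le k (F j)) -> cpoly_le k (fun v => \sum_(j <- r) F j v).
Proof.
move=> Fk; split.
  apply: eq_poly_le (poly_le_sum r (fun j => (Fk j).1)) => v.
  by rewrite (raddf_sum (@complex.Re R : Rcomplex R -> R)).
apply: eq_poly_le (poly_le_sum r (fun j => (Fk j).2)) => v.
by rewrite (raddf_sum (@complex.Im R : Rcomplex R -> R)).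
Qed.

(* The entries of P, those of the rows of L outside the range of f, and the
   three scalars of degenerate_chart. *)
Definition chart_param r (f : {ffun 'I_r -> 'I_n}) : finType :=
  ('I_r * 'I_r + {i : 'I_n | i \notin codom f} * 'I_r * bool + 'I_3)%type.

Section Chart.
Context {r : nat} {f : {ffun 'I_r -> 'I_n}}.
Implicit Types v : chart_param f -> R.

(** The rows of L in the range of [f] are fixed to those of the identity; this saving is what brings
    the parameter count below n^2. *)
Definition chart_left v (i : 'I_n) (j : 'I_r) : C :=
  if insub i is Some u then
    Complex (v (inl (inr (u, j, true)))) (v (inl (inr (u, j, false))))
  else (f j == i)%:R.

Definition chart_mid v (k l : 'I_r) : C :=
  Complex ((v (inl (inl (k, l))) + v (inl (inl (l, k)))) / 2)
          ((v (inl (inl (k, l))) - v (inl (inl (l, k)))) / 2).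

(** The equation a + x b + y b' = L P L^* + l solved for a, in real coordinates; the three scalars
    stand for l, -x and -y. *)
Definition chart (b b' : 'M[R]_n) (ij : 'I_n * 'I_n) v : R :=
  rcoord (\sum_k (\sum_l chart_left v ij.1 l * chart_mid v l k) *
      (chart_left v ij.2 k)^*)
    + ((ij.1 == ij.2)%:R * v (inr ord0) + (b ij.1 ij.2 * v (inr 1)
    + b' ij.1 ij.2 * v (inr ord_max))).

Lemma chart_left_poly i j : cpoly_le 1 (fun v => chart_left v i j).
Proof.
rewrite /chart_left; case: insub => [u|]; split.
- exact: poly_le_var.
- exact: poly_le_var.
- exact: poly_le_cst.
- exact: poly_le_cst.
Qed.

Lemma chart_mid_poly k l : cpoly_le 1 (fun v => chart_mid v k l).
Proof.
split; rewrite /chart_mid /=.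
  apply: (@eq_poly_le _ _ (fun v => 2^-1 *
    (v (inl (inl (k, l))) + v (inl (inl (l, k)))))).
    by move=> v; rewrite mulrC.
  by apply/poly_leMl/poly_leD; exact: poly_le_var.
apply: (@eq_poly_le _ _ (fun v => 2^-1 *
  (v (inl (inl (k, l))) + (-1) * v (inl (inl (l, k)))))).
  by move=> v; rewrite mulrC mulN1r.
by apply/poly_leMl/poly_leD; [|apply/poly_leMl]; exact: poly_le_var.
Qed.

Lemma chart_poly b b' ij : poly_le 3 (chart b b' ij).
Proof.
apply: poly_leD; last first.
  by do ![apply: poly_leD]; apply/poly_leMl/poly_le_var.
suff [rP iP] : cpoly_le 3 (fun v =>
    \sum_k (\sum_l chart_left v ij.1 l * chart_mid v l k) * (chart_left v ij.2 k)^*).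
  exact: poly_leD.
apply: cpoly_le_sum => k; apply: (@cpoly_leM _ 2 1).
  apply: cpoly_le_sum => l; apply: (@cpoly_leM _ 1 1).
    exact: chart_left_poly.
  exact: chart_mid_poly.
exact/cpoly_le_conj/chart_left_poly.
Qed.

(** The count is n^2 - (n - r)^2 + 3, and (n - r)^2 >= 4. Codimension 3 thus leaves room for the two
    parameters of a triangle, which is where dimension 2 enters. *)
Lemma card_chart_param : injective f -> (r + 2 <= n)%N ->
  (#|chart_param f| < #|{: 'I_n * 'I_n}|)%N.
Proof.
move=> f_inj rn; rewrite !card_sum !card_prod !card_ord card_sig card_bool.
have -> : #|[pred x | x \notin codom f]| = (n - r)%N.
  have := cardC (mem (codom f)); rewrite card_codom // !card_ord => E.
  apply: (@addnI r); rewrite subnKC; last exact: leq_trans (leq_addr _ _) rn.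
  by apply: etrans E; congr addn; apply: eq_card => x; rewrite !inE.
nia.
Qed.

End Chart.

Lemma hermsymB_scalar (H : 'M[C]_n) (l : R) :
  H \is hermsymmx -> H - ((l%:C)%C)%:M \is hermsymmx.
Proof.
move=> /hermsymP HH; apply/hermsymP => i j; rewrite !mxE (HH i j) rmorphB /=.
by congr (_ - _); rewrite eq_sym rmorphMn /= conj_Complex oppr0.
Qed.

Lemma degenerate_chart (a b b' : 'M[R]_n) (x y : R) :
    degenerate (a + x *: b + y *: b') ->
  exists r (f : {ffun 'I_r -> 'I_n}) (v : chart_param f -> R),
    [/\ (r + 2 <= n)%N, injective f & forall i j, chart b b' (i, j) v = a i j].
Proof.
case=> l rk; set H := _ - _ in rk.
have HH : H \is hermsymmx.
  exact/hermsymB_scalar/herm_of_herm.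
have HijE i j : rcoord (H i j) = a i j + x * b i j + y * b' i j - (i == j)%:R * l.
  rewrite /H mxE rcoordD [X in _ + rcoord X]mxE rcoordN rcoord_herm_of !mxE.
  by case: eqP => _; rewrite /rcoord ?mulr1n ?mulr0n /= ?addr0 ?mul1r ?mul0r.
clearbody H.
have [f [L [P [f_inj /hermsymP PP fL HE]]]] := hermitian_rank_decomp HH.
(* As P is hermitian, [chart_mid] recovers it from the values [rcoord (P k l)]; the rows of L in the
   range of [f] are known from [fL]. *)
pose v (t : chart_param f) : R := match t with
  | inl (inl (k, l)) => rcoord (P k l)
  | inl (inr (u, j, c)) => let z := L (val u) j in
                           if c then complex.Re z else complex.Im z
  | inr k => if k == 0 then l else if k == 1 then - x else - y
  end.
exists _, f, v; split => // i j.
have vL i' j' : chart_left v i' j' = L i' j'.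
  rewrite /chart_left; case: insubP => [u _ uE|].
    by rewrite /= uE; case: (L i' j').
  rewrite negbK => /codomP[k ->]; rewrite (inj_eq f_inj).
  by move/matrixP/(_ k j') : fL; rewrite !mxE eq_sym => ->.
have vP k k' : chart_mid v k k' = P k k'.
  rewrite /chart_mid /= (PP k k'); case: (P k' k) => p q.
  by rewrite conj_Complex /rcoord /=; congr Complex; field.
have Hij : \sum_k (\sum_l chart_left v i l * chart_mid v l k) *
    (chart_left v j k)^* = H i j.
  have /matrixP/(_ i j) := HE; rewrite mxE => E.
  apply: etrans (esym E); apply: eq_bigr => k _; rewrite vL !mxE; congr (_ * _).
  by apply: eq_bigr => k' _; rewrite vL vP.
rewrite /chart Hij HijE /=; ring.
Qed.
End Charts.

Lemma generic_nondegenerate (R : rcfType) n (S : finType) (b : S -> 'M[R]_n)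
    (a0 : 'M[R]_n) (del : R) : 0 < del ->
  exists2 a : 'M[R]_n, (forall i j, `|a i j - a0 i j| < del) &
    forall s s' x y, ~ degenerate (a + x *: b s + y *: b s').
Proof.
move=> del0; pose good (c : {r : 'I_n & {ffun 'I_r -> 'I_n}}) :=
  (tag c + 2 <= n)%N && injectiveb (tagged c).
(* One chart for each rank, row selection and pair of earlier matrices: finitely many, so all are
   avoided at once. *)
pose A := ({c | good c} * S * S)%type.
have [y y0 yq] := @poly_image_avoid R A
  (fun c => chart_param (tagged (val c.1.1))) #|{: 'I_n * 'I_n}| 3
  (fun c ij v => chart (b c.1.2) (b c.2) (enum_val ij) v)
  (fun ij => a0 (enum_val ij).1 (enum_val ij).2) del
  (fun c => let: conj rn f_inj := andP (valP c.1.1) in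
    card_chart_param (injectiveP _ f_inj) rn)
  (fun c ij => chart_poly _ _ _) del0.
exists (\matrix_(i, j) y (enum_rank (i, j))).
  by move=> i j; rewrite mxE; have := y0 (enum_rank (i, j)); rewrite enum_rankK.
move=> s s' x x' /degenerate_chart[r [f [v [rn f_inj vE]]]].
have r_ltn : (r < n)%N by apply: leq_trans rn; rewrite addn2.
pose c : {r : 'I_n & {ffun 'I_r -> 'I_n}} := Tagged _ (f : {ffun 'I_(Ordinal r_ltn) -> 'I_n}).
have cP : good c by rewrite /good rn; exact/injectiveP.
have [ij] := yq (Sub c cP, s, s') v.
rewrite -(enum_valK ij); case: (enum_val ij) => i j.
by rewrite enum_rankK /= vE mxE eqxx.
Qed.

(** * Approximation over a normal space of dimension two *)

(** Merging the V_j assigned to the same U_i does not raise the order: the indices i active at x are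
    images of the indices j active at x. The refinement inherits the index type, hence
    countability. *)
Lemma covering_dim_refine (X : topologicalType) (d : nat) (I : Type) (U : I -> set X) :
    covering_dim_le X d -> (forall i, open (U i)) -> \bigcup_i U i = setT ->
  exists W : I -> set X,
    [/\ forall i, open (W i), forall x, exists i, W i x,
        forall i, W i `<=` U i & forall x, [set i | W i x] #<= `I_d.+1].
Proof.
move=> dim oU cU; have [J [V [oV cV refV ordV]]] := dim I U oU cU.
have [h hP] := choice refV.
exists (fun i => \bigcup_(j in [set j | h j = i]) V j); split.
- by move=> i; apply: bigcup_open => j _.
- move=> x; have [j _ jx] : (\bigcup_j V j) x by rewrite cV.
  by exists (h j), j.
- by move=> i x [j <-]; exact: hP.
- move=> x; apply: card_le_trans (ordV x).
  apply: card_le_trans (card_image_le h _).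
  by apply: subset_card_le => i [j hj jx]; exists j.
Qed.

Lemma normal_urysohn_fun (R : realType) (X : topologicalType) (A B : set X) :
    normal_space X -> closed A -> closed B -> A `&` B = set0 ->
  exists u : X -> R, [/\ continuous u, forall x, 0 <= u x <= 1,
    forall x, A x -> u x = 0 & forall x, B x -> u x = 1].
Proof.
move=> /normal_separatorP sep cA cB AB.
have /(@uniform_separatorP _ R)[u [cu u01 u0 u1]] := sep R _ _ cA cB AB.
exists u; split => // x.
- by have := u01 (u x); rewrite /= in_itv /=; apply; exists x.
- by move=> Ax; apply: u0; exists x.
- by move=> Bx; apply: u1; exists x.
Qed.

(** * Shrinking a point-finite countable cover to cozero sets *)

Section Shrinking.
Context {R : realType} {X : topologicalType}.
Variable W : nat -> set X.

(** In the pair (m, O), O stands for the union of the cozero sets already built. The invariant is a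
    premise, so that a choice function is defined on all pairs and the invariant can be proved after
    the recursion. *)
Definition shrink_step (p : nat * set X) (u : X -> R) : Prop :=
  open p.2 -> (forall x, p.2 x \/ exists2 m, (p.1 <= m)%N & W m x) ->
  [/\ continuous u, forall x, 0 <= u x <= 1, forall x, ~ W p.1 x -> u x = 0
    & forall x, [\/ p.2 x, u x = 1 | exists2 m, (p.1 < m)%N & W m x]].

Lemma shrink_step_ex : normal_space X -> (forall m, open (W m)) ->
  forall p, exists u, shrink_step p u.
Proof.
move=> nX oW [m O]; have [oO|nO] := pselect (open O); last by exists (fun=> 0) => /nO.
pose tl := \bigcup_(k in [set k | (m < k)%N]) W k.
have [c|nc] := pselect (forall x, O x \/ exists2 k, (m <= k)%N & W k x); last first.
  by exists (fun=> 0) => _ /nc.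
(* The two closed sets are disjoint because O and the W k with k >= m cover X. *)
have [|||u [cu u01 u0 u1]] := @normal_urysohn_fun R X (~` W m) (~` (O `|` tl)) nX.
- exact/open_closedC.
- by apply/open_closedC/openU => //; exact: bigcup_open.
- apply/seteqP; split=> // x /= [Wmx /not_orP[Ox tlx]].
  have [//|[k mk Wkx]] := c x; apply: tlx; exists k => //=.
  by rewrite ltn_neqAle mk andbT; apply/eqP => mkE; apply: Wmx; rewrite mkE.
exists u => _ _; split => // x.
have [Ox|Ox] := pselect (O x); first by constructor 1.
have [[k mk Wkx]|tlx] := pselect (tl x); first by constructor 3; exists k.
by constructor 2; apply: u1 => -[].
Qed.

(* The u m are built one index at a time, so that the sets {u k <> 0} for k < m
   and W k for k >= m always cover X; point-finiteness gives the conclusion. *)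
Lemma normal_shrink : normal_space X -> (forall m, open (W m)) ->
    (forall x, exists m, W m x) ->
    (forall x, exists N, forall m, (N <= m)%N -> ~ W m x) ->
  exists u : nat -> X -> R, [/\ forall m, continuous (u m),
    forall m x, 0 <= u m x <= 1, forall m x, ~ W m x -> u m x = 0
    & forall x, exists m, u m x != 0].
Proof.
move=> nX oW cW pfW; have [sel selP] := choice (shrink_step_ex nX oW).
pose O := fix O m : set X :=
  if m is k.+1 then O k `|` [set x | sel (k, O k) x != 0] else set0.
have inv m : open (O m) /\ forall x, O m x \/ exists2 k, (m <= k)%N & W k x.
  elim: m => [|m [oO cO]].
    by split; [exact: open0|move=> x; right; have [k] := cW x; exists k].
  have [/= cu u01 u0 ucov] := selP (m, O m) oO cO; split.
    apply: openU => //; apply: (@open_comp _ _ _ [set y : R | y != 0]).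
      by move=> x _; exact: cu.
    exact: open_neq.
  move=> x; have [Ox|ux|] := ucov x; last by right.
    by left; left.
  by left; right; rewrite /= ux oner_neq0.
have selW m := selP (m, O m) (inv m).1 (inv m).2.
exists (fun m => sel (m, O m)); split.
- by move=> m; case: (selW m).
- by move=> m; case: (selW m).
- by move=> m; case: (selW m).
- move=> x; have [N NP] := pfW x.
  have : O N x by have [//|[k /NP]] := (inv N).2 x.
  elim: N {NP} => [//|N IH] /= [/IH//|ux]; by exists N.
Qed.
End Shrinking.

(** Nothing bounds [N] near a point; continuity comes from uniform convergence, the first M terms
    being everywhere within 2 * 2^-M of the sum. *)
Lemma continuous_series (R : realType) (X : topologicalType)
    (h : nat -> X -> R) (N : X -> nat) :
    (forall m, continuous (h m)) -> (forall m x, `|h m x| <= 2^-1 ^+ m) ->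
    (forall x m, (N x <= m)%N -> h m x = 0) ->
  continuous (fun x => \sum_(m < N x) h m x).
Proof.
move=> ch hb h0.
have sumE x M : (N x <= M)%N -> \sum_(m < N x) h m x = \sum_(m < M) h m x.
  move=> NM; rewrite -!(big_mkord xpredT (h^~ x)) [RHS](@big_cat_nat _ _ _ (N x)) //=.
  rewrite [X in _ + X]big_nat_cond [X in _ + X]big1 ?addr0 // => m /andP[/andP[+ _] _].
  exact: h0.
have tail x M : `|\sum_(m < N x) h m x - \sum_(m < M) h m x| <= 2 * 2^-1 ^+ M.
  pose L := maxn (N x) M.
  rewrite (sumE x L) ?leq_maxl // -!(big_mkord xpredT (h^~ x)).
  rewrite (@big_cat_nat _ _ _ M) ?leq_maxr //= addrAC subrr add0r.
  apply: le_trans (ler_norm_sum _ _ _) _.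
  (* The geometric bound in telescoped form, which passes through the induction on k. *)
  suff H k : \sum_(M <= m < M + k) `|h m x| <= 2 * (2^-1 ^+ M - 2^-1 ^+ (M + k)).
    have ML : (M <= L)%N by exact: leq_maxr.
    rewrite -(subnKC ML); apply: le_trans (H _) _.
    by rewrite ler_pM2l // gerBl exprn_ge0 // invr_ge0.
  elim: k => [|k IH]; first by rewrite addn0 big_geq // subrr mulr0.
  rewrite addnS big_nat_recr ?leq_addr //=.
  have := hb (M + k)%N x; rewrite exprS; lra.
move=> x; apply/cvgrPdist_lt => e e0.
have [M Me] : exists M : nat, 2 * 2^-1 ^+ M < e / 3.
  have e6 : 0 < e / 6 by rewrite divr_gt0.
  have [M _ /(_ M (leqnn M))] := near_infty_natSinv_expn_lt (PosNum e6).
  by rewrite /= div1r -exprVn => ?; exists M; lra.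
have cM : continuous (fun x => \sum_(m < M) h m x).
  elim: (M) => [|k IH] z.
    under eq_fun do rewrite big_ord0; exact: cvg_cst.
  under eq_fun do rewrite big_ord_recr /=.
  by apply: cvgD; [exact: IH|exact: ch].
have /cvgrPdist_lt/(_ (e / 3)) := cM x; rewrite divr_gt0 // => /(_ isT).
apply: filterS => y; have := tail x M; have := tail y M.
rewrite !ler_norml !ltr_norml => /andP[? ?] /andP[? ?] /andP[? ?].
by apply/andP; split; lra.
Qed.

(** Each A m is chosen generic with respect to the list of its predecessors. A term with zero
    coefficient may carry any index, so the statement also covers vertices and edges. *)
Lemma generic_sequence (R : rcfType) n (c : nat -> 'M[R]_n) (del : nat -> R) :
    (forall m, 0 < del m) ->
  exists2 A : nat -> 'M[R]_n, (forall m i j, `|A m i j - c m i j| < del m) &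
    forall m j k x y, (x != 0 -> (j < m)%N) -> (y != 0 -> (k < m)%N) ->
      ~ degenerate (A m + x *: A j + y *: A k).
Proof.
(* The index range exceeds the history by one, hence is inhabited even for the empty history; the
   extra index reads the default 0 of [nth]. *)
move=> del0; pose good (p : nat * seq 'M[R]_n) (a : 'M[R]_n) :=
  (forall i j, `|a i j - c p.1 i j| < del p.1) /\
  forall (s s' : 'I_(size p.2).+1) x y,
    ~ degenerate (a + x *: nth 0 p.2 s + y *: nth 0 p.2 s').
have /choice[sel selP] : forall p, exists a, good p a.
  case=> m h; have [a ca da] := @generic_nondegenerate R n 'I_(size h).+1
    (fun s => nth 0 h s) (c m) (del m) (del0 m).
  by exists a; split.
pose hist := fix hist m := if m is k.+1 then rcons (hist k) (sel (k, hist k)) else [::].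
pose A m := sel (m, hist m); exists A => [m i j|m j k x y jm km].
  by have [] := selP (m, hist m).
have size_hist l : size (hist l) = l by elim: l => //= l IH; rewrite size_rcons IH.
have nth_hist l i : (i < l)%N -> nth 0 (hist l) i = A i.
  elim: l => // l IH; rewrite ltnS leq_eqVlt /= nth_rcons size_hist => /orP[/eqP->|il].
    by rewrite ltnn eqxx.
  by rewrite il IH.
have idx i z : (z != 0 -> (i < m)%N) ->
    exists s : 'I_(size (hist m)).+1, z *: A i = z *: nth 0 (hist m) s.
  have [->|z0 /(_ isT) im] := eqVneq z 0; first by exists ord0; rewrite !scale0r.
  by exists (inord i); rewrite inordK ?nth_hist // size_hist ltnS ltnW.
have [s ->] := idx j x jm; have [s' ->] := idx k y km.
by have [_] := selP (m, hist m); apply.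
Qed.

Lemma matrix_rat_dense (R : realType) n (a : 'M[R]_n) (d : R) : 0 < d ->
  exists q : 'M[rat]_n, forall i j, `|a i j - ratr (q i j)| < d.
Proof.
move=> d0; have H (ij : 'I_n * 'I_n) : exists q : rat, `|a ij.1 ij.2 - ratr q| < d.
  have [|q] := @rat_in_itvoo R (a ij.1 ij.2 - d) (a ij.1 ij.2 + d); first by lra.
  by rewrite in_itv /= => /andP[? ?]; exists q; rewrite ltr_norml; lra.
have [q qP] := choice H; exists (\matrix_(i, j) q (i, j)) => i j.
by rewrite mxE; exact: (qP (i, j)).
Qed.

(* The cover is indexed by pairs of a rational matrix and a mesh 1/(k+1). *)
Lemma countable_mesh_cover (R : realType) (X : topologicalType) n
    (F : X -> 'M[R]_n) (e : X -> R) :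
    (forall i j, continuous (fun x => F x i j)) -> continuous e ->
    (forall x, 0 < e x) ->
  exists (c : nat -> 'M[R]_n) (del : nat -> R) (U : nat -> set X),
    [/\ forall m, 0 < del m, forall m, open (U m), \bigcup_m U m = setT &
      forall m x, U m x ->
        (forall i j, `|F x i j - c m i j| < del m) /\ 2 * del m < e x].
Proof.
move=> cF ce e0; pose p m : 'M[rat]_n * nat := odflt (0, 0%N) (unpickle m).
pose c m : 'M[R]_n := \matrix_(i, j) ratr ((p m).1 i j).
(* Half the mesh: [2 * del m < e x] then says 1/(k+1) < e x, and 2 del bounds the error when F and A
   are both within del of c. *)
pose del m : R := (p m).2.+1%:R^-1 / 2.
exists c, del, (fun m => [set x | (forall i j, `|F x i j - c m i j| < del m) /\
  2 * del m < e x]).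
have del0 m : 0 < del m by rewrite divr_gt0 // invr_gt0 ltr0n.
split => // [m|].
  rewrite openE => x /= [Fx ex]; apply: filterI.
    apply: filter_forall => i; apply: filter_forall => j.
    have := cF i j x; have dF : 0 < del m - `|F x i j - c m i j| by rewrite subr_gt0.
    move/cvgrPdist_lt/(_ _ dF); apply: filterS => y.
    by rewrite distrC ltrBrDr => /(le_lt_trans _); apply; rewrite -[leLHS]/(`|_|);
      apply: le_trans (ler_normD _ _); rewrite addrA subrK.
  have := ce x; have dex : 0 < e x - 2 * del m by rewrite subr_gt0.
  move/cvgrPdist_lt/(_ _ dex); apply: filterS => y; rewrite ltr_norml => /andP[_]; lra.
apply/seteqP; split => // x _.
have [k _ /(_ k (leqnn k)) ke] := near_infty_natSinv_lt (PosNum (e0 x)).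
have d0 : 0 < (k.+1%:R^-1 / 2 : R) by rewrite divr_gt0 // invr_gt0 ltr0n.
have [q qF] := matrix_rat_dense (F x) d0.
exists (pickle (q, k)) => //=; rewrite /c /del /p pickleK /=; split.
  by move=> i j; rewrite mxE.
by rewrite mulrC divfK.
Qed.

Lemma card_le_ord_seq (T : choiceType) (A : set T) (d : nat) (s : seq T) :
  A #<= `I_d -> uniq s -> (forall x, x \in s -> A x) -> (size s <= d)%N.
Proof.
move=> Ad us sA; apply: leq_trans (geq_card_fset_set Ad).
apply: uniq_leq_size => // x /sA Ax; rewrite in_fset_set ?inE //.
by apply/finite_set_leP; exists d.
Qed.

Lemma card_le_ord_bounded (A : set nat) (d : nat) :
  A #<= `I_d -> exists N, forall m, (N <= m)%N -> ~ A m.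
Proof.
move=> Ad; have fA : finite_set A by apply/finite_set_leP; exists d.
exists (\max_(i <- finmap.enum_fset (fset_set A)) i).+1 => m Nm Am.
have mA : m \in finmap.enum_fset (fset_set A).
  by rewrite in_fset_set // inE.
by have := leq_trans Nm (leq_bigmax_seq m mA isT); rewrite ltnn.
Qed.

Theorem nondegenerate_approximation (R : realType) (X : topologicalType) n
    (F : X -> 'M[R]_n) (e : X -> R) :
    normal_space X -> covering_dim_le X 2 ->
    (forall i j, continuous (fun x => F x i j)) -> continuous e ->
    (forall x, 0 < e x) ->
  exists G : X -> 'M[R]_n, [/\ forall i j, continuous (fun x => G x i j),
    forall x i j, `|F x i j - G x i j| < e x & forall x, ~ degenerate (G x)].
Proof.
move=> nX dX cF ce e0.
have [c [del [U [del0 oU cU UP]]]] := countable_mesh_cover cF ce e0.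
have [W [oW cW WU ordW]] := covering_dim_refine dX oU cU.
have [N NP] := choice (fun x => card_le_ord_bounded (ordW x)).
have [u [cu u01 uW ucov]] := @normal_shrink R _ _ nX oW cW (fun x => ex_intro _ _ (NP x)).
have [A cA nondegA] := generic_sequence c del0.
(* The weights w m make the series of the w m A_m converge uniformly, so that no
   local finiteness is needed. *)
pose K m : R := 2^-1 ^+ m / (1 + \sum_ij `|A m ij.1 ij.2|).
have K1 m : 0 < 1 + \sum_ij `|A m ij.1 ij.2|.
  by rewrite ltr_pwDl // sumr_ge0.
have K0 m : 0 < K m by rewrite divr_gt0 // exprn_gt0 // invr_gt0.
pose w m x := u m x * K m.
have wge0 m x : 0 <= w m x.
  by rewrite mulr_ge0 ?(ltW (K0 _)) //; case/andP: (u01 m x).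
have wW m x : w m x != 0 -> W m x.
  by apply: contra_neqP => /uW ux; rewrite /w ux mul0r.
have wN x m : (N x <= m)%N -> w m x = 0.
  by move=> /NP nW; apply: contra_notP nW => /eqP /wW.
have wb m x (y : R) : `|y| <= 1 + \sum_ij `|A m ij.1 ij.2| -> `|w m x * y| <= 2^-1 ^+ m.
  move=> yb; rewrite normrM ger0_norm // -[leRHS](divfK (lt0r_neq0 (K1 m))).
  rewrite -/(K m) ler_pM // /w ler_piMl ?(ltW (K0 m)) //.
  by case/andP: (u01 m x).
have cw m (y : R) : continuous (fun x => w m x * y).
  by move=> x; apply: cvgM; [apply: cvgM; [exact: cu|exact: cvg_cst]|exact: cvg_cst].
pose S x := \sum_(m < N x) w m x.
have wpos x : exists m : 'I_(N x), 0 < w m x.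
  have [m um] := ucov x; have wm : w m x != 0 by rewrite mulf_neq0 // lt0r_neq0.
  have mN : (m < N x)%N by rewrite ltnNge; apply: contra wm => /wN ->.
  by exists (Ordinal mN); rewrite lt_def wm wge0.
have Spos x : 0 < S x.
  by have [m wm] := wpos x; rewrite /S (bigD1 m) //= ltr_pwDl ?sumr_ge0.
have cS : continuous S.
  have -> : S = (fun x => \sum_(m < N x) w m x * 1).
    by apply/funext => x; apply: eq_bigr => m _; rewrite mulr1.
  apply: (@continuous_series _ _ (fun m x => w m x * 1) N).
  - by move=> m; exact: cw.
  - by move=> m x; apply: wb; rewrite normr1 lerDl sumr_ge0.
  - by move=> x m /wN ->; rewrite mul0r.
pose T i j x := \sum_(m < N x) w m x * A m i j.
have cT i j : continuous (T i j).
  apply: (@continuous_series _ _ (fun m x => w m x * A m i j) N).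
  - by move=> m; exact: cw.
  - move=> m x; apply: wb; rewrite (bigD1 (i, j)) //= addrCA lerDl.
    by rewrite addr_ge0 // sumr_ge0.
  - by move=> x m /wN ->; rewrite mul0r.
pose G x := (S x)^-1 *: \sum_(m < N x) w m x *: A m.
have GE x i j : G x i j = (S x)^-1 * T i j x.
  rewrite /G mxE summxE; congr (_ * _).
  by apply: eq_bigr => m _; rewrite mxE.
exists G; split.
- move=> i j; have -> : (fun x => G x i j) = (fun x => (S x)^-1 * T i j x).
    by apply/funext => x; rewrite GE.
  move=> x; apply: cvgM; last exact: cT.
  by apply: cvgV; [exact: lt0r_neq0|exact: cS].
(* G is a weighted mean of the A m, each within e x of F x where its weight is non-zero; an index of
   positive weight makes the inequality strict. *)
- move=> x i j; rewrite GE -(ltr_pM2l (Spos x)) -{1}(gtr0_norm (Spos x)) -normrM.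
  rewrite mulrBr mulrA mulfV ?lt0r_neq0 // mul1r /S /T !mulr_suml -sumrB.
  have AF m : w m x != 0 -> `|F x i j - A m i j| < e x.
    move=> /wW/WU/UP[/(_ i j) Fc de]; apply: lt_trans de.
    have := cA m i j; rewrite !ltr_norml in Fc * => /andP[? ?].
    by case/andP: Fc => ? ?; apply/andP; split; lra.
  have AFw (m : 'I_(N x)) : `|w m x * F x i j - w m x * A m i j| <= w m x * e x.
    rewrite -mulrBr normrM ger0_norm //; have [->|/AF/ltW] := eqVneq (w m x) 0.
      by rewrite !mul0r.
    exact: ler_wpM2l.
  apply: le_lt_trans (ler_norm_sum _ _ _) _; have [m wm] := wpos x.
  rewrite (bigD1 m) // [ltRHS](bigD1 m) //= ltr_leD ?ler_sum //.
  by rewrite -mulrBr normrM gtr0_norm // ltr_pM2l // AF // lt0r_neq0.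
- move=> x.
  pose s := [seq m <- iota 0 (N x) | w m x != 0].
  have sumE : \sum_(m < N x) w m x *: A m = \sum_(m <- s) w m x *: A m.
    rewrite -(big_mkord xpredT (fun m => w m x *: A m)) big_filter [RHS]big_mkcond /=.
    rewrite /index_iota subn0; apply: eq_bigr => m _.
    by case: eqP => [->|//]; rewrite scale0r.
  have ss : sorted ltn s by apply: sorted_filter (iota_ltn_sorted _ _); exact: ltn_trans.
  have s3 : (size s <= 3)%N.
    apply: (card_le_ord_seq (ordW x)); first by rewrite filter_uniq // iota_uniq.
    by move=> m; rewrite mem_filter => /andP[/wW].
  have sw m : m \in s -> w m x != 0 by rewrite mem_filter => /andP[].
  have sne : s != [::].
    have [m wm] := wpos x; have : val m \in s.
      by rewrite mem_filter (lt0r_neq0 wm) mem_iota /=.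
    by case: (s).
  have key p y z j k : w p x != 0 -> (y != 0 -> (j < p)%N) -> (z != 0 -> (k < p)%N) ->
      ~ degenerate ((S x)^-1 *: (w p x *: (A p + y *: A j + z *: A k))).
    move=> wp jp kp; rewrite scalerA => /degenerateZ.
    rewrite mulf_neq0 ?invr_neq0 ?(lt0r_neq0 (Spos x)) //.
    by move=> /(_ isT); exact: nondegA.
  have -> : G x = (S x)^-1 *: \sum_(m <- s) w m x *: A m by rewrite -sumE.
  (* One, two or three active indices. The last is the largest: its matrix is factored out, and
     absent terms get coefficient 0. *)
  case: (s) sne ss s3 sw => [//|p [|q [|r [|//]]]] _ /=.
  + move=> _ _ sw; rewrite big_seq1.
    have := key p 0 0 p p; rewrite eqxx !scale0r !addr0; apply => //.
    by apply: sw; rewrite inE.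
  + rewrite andbT => pq _ sw; rewrite big_cons big_seq1.
    have wq : w q x != 0 by apply: sw; rewrite !inE eqxx orbT.
    have -> : w p x *: A p + w q x *: A q =
        w q x *: (A q + (w p x / w q x) *: A p + 0 *: A q).
      by rewrite scale0r addr0 scalerDr scalerA [_ * (_ / _)]mulrC divfK // addrC.
    by apply: key => //; rewrite eqxx.
  + rewrite andbT => /andP[pq qr] _ sw; rewrite !big_cons big_nil addr0.
    have wr : w r x != 0 by apply: sw; rewrite !inE eqxx !orbT.
    have -> : w p x *: A p + (w q x *: A q + w r x *: A r) =
        w r x *: (A r + (w p x / w r x) *: A p + (w q x / w r x) *: A q).
      rewrite !scalerDr !scalerA ![_ * (_ / _)]mulrC !divfK //.
      by rewrite addrA addrC addrA.
    by apply: key => // _; exact: ltn_trans qr.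
Qed.

(** * Continuity of complex coordinates and a bound on the operator norm *)

Section ComplexContinuity.
Context {R : realType}.
Local Notation C := R[i].

Lemma normC_normc (z : C) : `|z| = ((Normc.normc z)%:C)%C.
Proof. by []. Qed.

Lemma normc_ge0 (z : C) : 0 <= Normc.normc z.
Proof. by case: z => x y; exact: sqrtr_ge0. Qed.

Lemma rcoord_le (z : C) : `|rcoord z| <= 2 * Normc.normc z.
Proof.
case: z => x y; rewrite /rcoord /=; apply: le_trans (ler_normD _ _) _.
rewrite mulr2n mulrDl !mul1r lerD // -sqrtr_sqr ler_wsqrtr //.
  by rewrite lerDl sqr_ge0.
by rewrite lerDr sqr_ge0.
Qed.

Lemma normc_le (x y : R) : Normc.normc (Complex x y) <= `|x| + `|y|.
Proof.
rewrite /= -(ger0_norm (addr_ge0 (normr_ge0 x) (normr_ge0 y))) -sqrtr_sqr.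
rewrite ler_wsqrtr // sqrrD !real_normK ?num_real //.
have := mulr_ge0 (normr_ge0 x) (normr_ge0 y); lra.
Qed.

Lemma rcoord_continuous : continuous (@rcoord R : C -> R).
Proof.
move=> z; apply/(@cvgrPdist_lt _ _ _ (nbhs z) (nbhs_filter z)) => e e0.
have e2 : 0 < (((e / 2)%:C)%C : C) by rewrite ltcR divr_gt0.
have := nbhsx_ballx z _ e2; apply: filterS => w; rewrite -ball_normE /=.
rewrite normC_normc ltcR -rcoordN -rcoordD; have := rcoord_le (z - w); lra.
Qed.

Lemma Complex_continuous (X : topologicalType) (f g : X -> R) :
  continuous f -> continuous g -> continuous (fun x => Complex (f x) (g x) : C).
Proof.
move=> cf cg x; apply/cvgrPdist_lt => -[e e'] /=; rewrite ltcE /= => /andP[/eqP -> e0].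
have /cvgrPdist_lt/(_ _ (divr_gt0 e0 (ltr0n _ 2))) := cf x.
have /cvgrPdist_lt/(_ _ (divr_gt0 e0 (ltr0n _ 2))) := cg x.
apply: filterS2 => y gy fy; rewrite normC_normc ltcR.
by apply: le_lt_trans (normc_le _ _) _; rewrite [ltRHS](splitr e) ltrD.
Qed.

End ComplexContinuity.

(** A crude bound: the coordinates of a vector v of norm at most 1 have modulus at most 1, so those
    of A v have modulus at most n d, and n (n d)^2 <= (n^2 d)^2. *)
Lemma opnorm_le (R : realType) n (A : 'M[R[i]]_n) (d : R) : 0 <= d ->
  (forall i j, Normc.normc (A i j) <= d) -> opnorm A <= n%:R ^+ 2 * d.
Proof.
move=> d0 Ad; apply: ge_sup.
  exists (l2norm (A *m 0)), 0 => //=; rewrite /l2norm big1 ?sqrtr0 // => k _.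
  by rewrite mxE Normc.normc0 expr0n.
move=> _ [v v1 <-].
have vk k : Normc.normc (v k 0) <= 1.
  apply: le_trans v1; rewrite -[leLHS]ger0_norm ?normc_ge0 // -sqrtr_sqr.
  by rewrite ler_wsqrtr // (bigD1 k) //= lerDl sumr_ge0 // => ? _; exact: sqr_ge0.
have Avk k : Normc.normc ((A *m v) k 0) <= n%:R * d.
  rewrite mxE -lecR -normC_normc; apply: le_trans (ler_norm_sum _ _ _) _.
  rewrite (_ : ((n%:R * d)%:C)%C = \sum_(j < n) ((d%:C)%C : R[i])); last first.
    by rewrite sumr_const card_ord mulr_natl rmorphMn.
  apply: ler_sum => j _; rewrite normrM !normC_normc -rmorphM lecR.
  by rewrite -[leRHS]mulr1 ler_pM ?normc_ge0.
have nd0 : 0 <= n%:R * d by rewrite mulr_ge0.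
rewrite /l2norm -[leRHS]ger0_norm; last by rewrite mulr_ge0 // sqr_ge0.
rewrite -sqrtr_sqr ler_wsqrtr //.
apply: (@le_trans _ _ (\sum_(k < n) (n%:R * d) ^+ 2)).
  by apply: ler_sum => k _; rewrite lerXn2r // nnegrE ?normc_ge0.
rewrite sumr_const card_ord -[leLHS]mulr_natl.
rewrite (_ : n%:R ^+ 2 * d = n%:R * (n%:R * d)); last by rewrite mulrA expr2.
rewrite [leRHS]exprMn ler_wpM2r ?sqr_ge0 //.
by rewrite expr2 -natrM ler_nat; case: (n) => // k; rewrite leq_pmulr.
Qed.

Lemma matrix_continuousP (X T : topologicalType) m n (f : X -> 'M[T]_(m, n)) :
  continuous f <-> forall i j, continuous (fun x => f x i j).
Proof.
split=> [cf i j x A fxA|cf x A [P fP PA]].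
  apply: (cf x [set M | A (M i j)]).
  exists (fun i' j' => if (i', j') == (i, j) then A else setT).
    by move=> i' j'; case: eqP => [[-> ->]//|_]; exact: filterT.
  by move=> M /(_ i j); rewrite eqxx.
have : \forall y \near x, forall i j, P i j (f y i j).
  by apply: filter_forall => i; apply: filter_forall => j; exact: cf (fP i j).
by apply: filterS => y; exact: PA.
Qed.

Theorem theorem5p3 (R : realType) (X : topologicalType)
    (X_normal : normal_space X) (X_dim : covering_dim_le X 2)
    (n : nat) (n_ge1 : (1 <= n)%N)
    (f : X -> 'M[R[i]]_n) (f_sa : forall x, f x \is hermsymmx)
    (f_cont : continuous f)
    (eps : X -> R) (eps_gt0 : forall x, 0 < eps x)
    (eps_cont : continuous eps) :
  exists g : X -> 'M[R[i]]_n,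
    [/\ forall x, g x \is hermsymmx,
        continuous g
      & forall x, opnorm (f x - g x) < eps x /\
          [set a : R[i] | eigenvalue (g x) a] #= `I_n].
Proof.
(* Passing from real coordinates to complex entries costs a factor 2, from entries to the operator
   norm n^2; the added 1 makes the final inequality strict. *)
pose N : R := n%:R ^+ 2 * 2 + 1.
have N0 : 0 < N by rewrite ltr_wpDl // mulr_ge0 // sqr_ge0.
have [||x|G [cG FG nondeg]] := @nondegenerate_approximation R X n
  (fun x => herm_coord (f x)) (fun x => eps x / N) X_normal X_dim.
- move=> i j; have -> : (fun x => herm_coord (f x) i j) =
      @rcoord R \o (fun x => f x i j) by apply/funext => x; rewrite mxE.
  move=> x; apply: continuous_comp; last exact: rcoord_continuous.
  by have /matrix_continuousP := f_cont; exact.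
- by move=> x; apply: cvgM; [exact: eps_cont|exact: cvg_cst].
- by rewrite divr_gt0.
exists (fun x => herm_of (G x)); split => [x||x].
- exact: herm_of_herm.
- apply/matrix_continuousP => i j.
  have -> : (fun x => herm_of (G x) i j) = (fun x =>
      Complex ((G x i j + G x j i) / 2) ((G x i j - G x j i) / 2)).
    by apply/funext => x; rewrite mxE.
  apply: Complex_continuous => x; apply: cvgM; try exact: cvg_cst.
    by apply: cvgD; exact: cG.
  by apply: cvgB; exact: cG.
split.
  have e0 : 0 < eps x / N by rewrite divr_gt0.
  apply: (@le_lt_trans _ _ (n%:R ^+ 2 * (2 * (eps x / N)))).
    apply: opnorm_le => [|i j]; first by rewrite mulr_ge0 // ltW.
    have -> : f x - herm_of (G x) = herm_of (herm_coord (f x) - G x).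
      by rewrite herm_ofD -[- G x]scaleN1r herm_ofZ rmorphN1 scaleN1r herm_coordK.
    rewrite mxE; set b := _ - _; apply: le_trans (normc_le _ _) _.
    have bd k l : `|b k l| < eps x / N by rewrite /b mxE [X in _ + X]mxE; exact: FG.
    have := bd i j; have := bd j i; rewrite !ltr_norml => /andP[? ?] /andP[? ?].
    by rewrite [leRHS]mulr_natl [leRHS]mulr2n lerD // ler_norml; apply/andP; split; lra.
  rewrite mulrA -[ltRHS](divfK (lt0r_neq0 N0)) [ltRHS]mulrC ltr_pM2r //.
  by rewrite ltrDl.
have [d d_inj dE] := nondegenerate_spectrum (nondeg x).
have -> : [set z | eigenvalue (herm_of (G x)) z] = [set d i | i in setT].
  apply/seteqP; split => z /=; first by move=> /dE[i ->]; exists i.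
  by move=> [i _ <-]; apply/dE; exists i.
apply: card_eq_trans (inj_card_eq (in2W d_inj)) _; rewrite card_eq_sym.
have -> : `I_n = [set val i | i in [set: 'I_n]].
  apply/seteqP; split => [k /= kn|_ [i _ <-] //=]; first by exists (Ordinal kn).
exact: inj_card_eq (in2W val_inj).
Qed.
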